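(* Let $R$ be a commutative ring and let $M$ be an $R$-module. Then the following statements are equivalent: (i) $M$ is an arithmetical module. (ii) $M$ is a distributive module. (iii) $(K+L):_RN=(K:_RN)+(L:_RN)$ for all submodules $K,L,N$ of $M$ with $N$ finitely generated. (iv) $K:_R(L\cap N)=(K:_RL)+(K:_RN)$ for all submodules $K,L,N$ of $M$ with $L$ and $N$ finitely generated. (v) Every finitely generated submodule of $M$ is a multiplication module.
   Context: All rings are commutative with non-zero identity. An $R$-module $M$ is arithmetical if for each maximal ideal $\mathfrak m$ of $R$ the submodules of the $R_{\mathfrak m}$-module $M_{\mathfrak m}$ are linearly ordered by inclusion. A submodule $N$ of $M$ is distributive if $(K+L)\cap N=(K\cap N)+(L\cap N)$ for all submodules $K,L$ of $M$ (equivalently, $(K\cap L)+N=(K+N)\cap(L+N)$ for all $K,L$); $M$ is distributive if every submodule of $M$ is distributive. For submodules $A,B$ of $M$, $A:_RB=\{r\in R: rB\subseteq A\}$. A module $X$ is a multiplication module if every submodule of $X$ is of the form $\mathfrak bX$ for some ideal $\mathfrak b$ of $R$. *)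

(* Defs.v *)
From HB Require Import structures.
From mathcomp Require Import all_boot all_order all_algebra.
From mathcomp Require Import generic_quotient.
From mathcomp Require Import boolp classical_sets.
From mathcomp Require Import ring.

Set Implicit Arguments.
Unset Strict Implicit.
Unset Printing Implicit Defensive.

Import GRing.Theory.
Local Open Scope classical_set_scope.
Local Open Scope quotient_scope.
Local Open Scope ring_scope.

Definition is_submodule (R : comNzRingType) (M : lmodType R) (N : set M) : Prop :=
  GRing.submod_closed [in N].

Lemma is_submoduleP (R : comNzRingType) (M : lmodType R) (N : set M) :
  is_submodule N <->
  N 0 /\ (forall (a : R) (x y : M), N x -> N y -> N (a *: x + y)).
Proof.
split=> [[N0 Nl]|[N0 Nl]]; split.
- by move: N0; rewrite inE.
- by move=> a x y Nx Ny; apply/set_mem; apply: Nl; apply/mem_set.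
- by apply/mem_set.
- by move=> a x y /set_mem Nx /set_mem Ny; apply/mem_set; apply: Nl.
Qed.

(* Not [ring_quotient.idealr_closed], which only allows proper ideals. *)
Definition is_ideal (R : comNzRingType) (I : set R) : Prop :=
  is_submodule (I : set R^o).

(* The submodule generated by [X]. *)
Definition span (R : comNzRingType) (M : lmodType R) (X : set M) : set M :=
  smallest (@is_submodule R M) X.

Definition sum_set (V : zmodType) (A B : set V) : set V :=
  [set x + y | x in A & y in B].

Definition colon (R : comNzRingType) (M : lmodType R) (A B : set M) : set R :=
  [set r | forall x, B x -> A (r *: x)].

Definition ideal_mul (R : comNzRingType) (M : lmodType R) (I : set R) (X : set M)
    : set M :=
  span [set a *: x | a in I & x in X].

Definition finitely_generated (R : comNzRingType) (M : lmodType R) (N : set M)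
    : Prop :=
  exists s : seq M, N = span [set` s].

(* A submodule [X] of [M] regarded as a module in its own right: its submodules
   are the submodules of [M] contained in [X]. *)
Definition multiplication_module (R : comNzRingType) (M : lmodType R) (X : set M)
    : Prop :=
  forall Y : set M, is_submodule Y -> Y `<=` X ->
    exists2 b : set R, is_ideal b & Y = ideal_mul b X.

Definition distributive_submodule (R : comNzRingType) (M : lmodType R) (N : set M)
    : Prop :=
  forall K L : set M, is_submodule K -> is_submodule L ->
    sum_set K L `&` N = sum_set (K `&` N) (L `&` N).

Definition distributive_module (R : comNzRingType) (M : lmodType R) : Prop :=
  forall N : set M, is_submodule N -> distributive_submodule N.

Record maximal_ideal (R : comNzRingType) := MaximalIdeal {
  maximal_set : set R;
  maximal_set_ideal : is_ideal maximal_set;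
  maximal_set_proper : maximal_set <> setT;
  maximal_set_max : forall J : set R,
    is_ideal J -> maximal_set `<=` J -> J <> setT -> J = maximal_set
}.

Section Denominators.
Variables (R : comNzRingType) (m : maximal_ideal R).

Lemma maximal0 : maximal_set m 0.
Proof. by have /is_submoduleP[] := maximal_set_ideal m. Qed.

Lemma maximal_lin (a x y : R) : maximal_set m x -> maximal_set m y -> maximal_set m (a * x + y).
Proof. by have /is_submoduleP[_ h] := maximal_set_ideal m; apply: h. Qed.

Lemma maximalMl (a x : R) : maximal_set m x -> maximal_set m (a * x).
Proof. by move=> mx; rewrite -[_ * _]addr0; apply: maximal_lin => //; exact: maximal0. Qed.

Lemma maximal1 : ~ maximal_set m 1.
Proof.
move=> m1; apply: (@maximal_set_proper R m); apply/seteqP; split=> // x _.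
by rewrite -[x]mulr1; apply: maximalMl.
Qed.

Lemma maximal_prime (s t : R) : ~ maximal_set m s -> ~ maximal_set m t -> ~ maximal_set m (s * t).
Proof.
move=> ms mt mst.
pose J : set R := [set x | exists a, maximal_set m (x - a * s)].
have iJ : is_ideal J.
  apply/is_submoduleP; split; first by exists 0; rewrite mul0r subr0; exact: maximal0.
  move=> a x y [b mb] [c mc]; exists (a * b + c).
  have -> : a *: (x : R^o) + y - (a * b + c) * s = a * (x - b * s) + (y - c * s).
    by rewrite /GRing.scale /=; ring.
  exact: maximal_lin.
have mJ : maximal_set m `<=` J by move=> x mx; exists 0; rewrite mul0r subr0.
have Js : J s by exists 1; rewrite mul1r subrr; exact: maximal0.
have [JT|/(maximal_set_max iJ mJ) Jm] := pselect (J = setT); last first.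
  by apply: ms; rewrite -Jm.
have [a ma] : J 1 by rewrite JT.
apply: mt; have -> : t = a * (s * t) + t * (1 - a * s) by ring.
by apply: maximal_lin => //; apply: maximalMl.
Qed.

Definition denominator := {s : R | s \notin maximal_set m}.

Definition dval (s : denominator) : R := val s.

Lemma denomP (s : denominator) : ~ maximal_set m (dval s).
Proof. by move=> ms; have /negP := valP s; apply; apply/mem_set. Qed.

Lemma notin_maximal (s : R) : ~ maximal_set m s -> s \notin maximal_set m.
Proof. by move=> ms; apply/negP => /set_mem. Qed.

Definition denom1 : denominator := Sub 1 (notin_maximal maximal1).

Definition denom_mul (s t : denominator) : denominator :=
  Sub (dval s * dval t) (notin_maximal (maximal_prime (denomP (s := s)) (denomP (s := t)))).

Lemma dval_denom1 : dval denom1 = 1. Proof. by []. Qed.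

Lemma dval_denom_mul s t : dval (denom_mul s t) = dval s * dval t. Proof. by []. Qed.

Definition dval_denomE := (dval_denom1, dval_denom_mul).

End Denominators.

Section LocalizationType.
Variables (R : comNzRingType) (m : maximal_ideal R) (M : lmodType R).

Definition frac_eq (p q : M * denominator m) : bool :=
  `[< exists2 u : R, ~ maximal_set m u & u *: (dval q.2 *: p.1) = u *: (dval p.2 *: q.1) >].

Lemma frac_eq_refl : reflexive frac_eq.
Proof. by move=> p; apply/asboolP; exists 1 => //; exact: maximal1. Qed.

Lemma frac_eq_sym : symmetric frac_eq.
Proof.
by move=> p q; apply/asbool_equiv_eq; split=> -[u mu e]; exists u.
Qed.

Lemma frac_eq_trans : transitive frac_eq.
Proof.
move=> q p r /asboolP[u mu e1] /asboolP[v mv e2]; apply/asboolP.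
exists (u * v * dval q.2).
  by apply: maximal_prime; [exact: maximal_prime|exact: denomP].
transitivity ((v * dval r.2) *: (u *: (dval q.2 *: p.1))).
  by rewrite !scalerA; congr (_ *: _); ring.
transitivity ((u * dval p.2) *: (v *: (dval r.2 *: q.1))).
  by rewrite e1 !scalerA; congr (_ *: _); ring.
by rewrite e2 !scalerA; congr (_ *: _); ring.
Qed.

Canonical frac_equiv := EquivRel frac_eq frac_eq_refl frac_eq_sym frac_eq_trans.

(* The localization of [M] at the maximal ideal [m]. *)
Definition localization := {eq_quot frac_equiv}.

HB.instance Definition _ := Choice.on localization.
HB.instance Definition _ := EqQuotient.on localization.

Definition frac (x : M) (s : denominator m) : localization := \pi_localization (x, s).

Lemma fracP (x y : M) (s t : denominator m) :
  frac x s = frac y t <->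
  exists2 u : R, ~ maximal_set m u & u *: (dval t *: x) = u *: (dval s *: y).
Proof.
split=> [/eqmodP /asboolP //|h].
by apply/eqmodP/asboolP.
Qed.

Lemma frac_repr (p : localization) : p = frac (repr p).1 (repr p).2.
Proof. by rewrite /frac -surjective_pairing reprK. Qed.

Lemma fracW (P : localization -> Prop) :
  (forall x s, P (frac x s)) -> forall p, P p.
Proof. by move=> h p; rewrite (frac_repr p). Qed.

Definition loc_add (p q : localization) : localization :=
  frac (dval (repr q).2 *: (repr p).1 + dval (repr p).2 *: (repr q).1)
       (denom_mul (repr p).2 (repr q).2).

Definition loc_opp (p : localization) : localization :=
  frac (- (repr p).1) (repr p).2.

Lemma loc_addE x y s t :
  loc_add (frac x s) (frac y t) =
  frac (dval t *: x + dval s *: y) (denom_mul s t).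
Proof.
rewrite /loc_add.
case: (repr (frac x s)) (frac_repr (frac x s)) => x' s' /= /fracP[u mu e].
case: (repr (frac y t)) (frac_repr (frac y t)) => y' t' /= /fracP[v mv f].
apply/fracP; exists (u * v); first exact: maximal_prime.
rewrite ?dval_denomE !scalerDr; congr (_ + _).
  transitivity ((v * dval t' * dval t) *: (u *: (dval s *: x'))).
    by rewrite !scalerA; congr (_ *: _); ring.
  by rewrite -e !scalerA; congr (_ *: _); ring.
transitivity ((u * dval s' * dval s) *: (v *: (dval t *: y'))).
  by rewrite !scalerA; congr (_ *: _); ring.
by rewrite -f !scalerA; congr (_ *: _); ring.
Qed.

Lemma loc_oppE x s : loc_opp (frac x s) = frac (- x) s.
Proof.
rewrite /loc_opp.
case: (repr (frac x s)) (frac_repr (frac x s)) => x' s' /= /fracP[u mu e].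
by apply/fracP; exists u; rewrite // !scalerN e.
Qed.

Let eq_frac x y s t : dval t *: x = dval s *: y -> frac x s = frac y t.
Proof. by move=> e; apply/fracP; exists 1; [exact: maximal1|rewrite e]. Qed.

Lemma loc_addA : associative loc_add.
Proof.
move=> p q r; elim/fracW: p => x s; elim/fracW: q => y t; elim/fracW: r => z u.
rewrite !loc_addE; apply: eq_frac; rewrite ?dval_denomE.
by rewrite !scalerDr !scalerA addrA; congr (_ *: _ + _ *: _ + _ *: _); ring.
Qed.

Lemma loc_addC : commutative loc_add.
Proof.
move=> p q; elim/fracW: p => x s; elim/fracW: q => y t.
rewrite !loc_addE; apply: eq_frac; rewrite ?dval_denomE.
by rewrite addrC !scalerDr !scalerA; congr (_ *: _ + _ *: _); ring.
Qed.

Lemma loc_add0 : left_id (frac 0 (denom1 m)) loc_add.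
Proof.
move=> p; elim/fracW: p => x s; rewrite loc_addE; apply: eq_frac; rewrite ?dval_denomE.
by rewrite scaler0 add0r !scalerA; congr (_ *: _); ring.
Qed.

Lemma loc_addN : left_inverse (frac 0 (denom1 m)) loc_opp loc_add.
Proof.
move=> p; elim/fracW: p => x s; rewrite loc_oppE loc_addE; apply: eq_frac; rewrite ?dval_denomE.
by rewrite scalerN addNr !scaler0.
Qed.

HB.instance Definition _ :=
  GRing.isZmodule.Build localization loc_addA loc_addC loc_add0 loc_addN.

Lemma frac_addE x y s t :
  frac x s + frac y t = frac (dval t *: x + dval s *: y) (denom_mul s t).
Proof. exact: loc_addE. Qed.

End LocalizationType.

Section LocalRing.
Variables (R : comNzRingType) (m : maximal_ideal R).

(* The local ring [R_m], with underlying group the localization of [R] as a module. *)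
Definition local_ring := localization m R^o.

HB.instance Definition _ := GRing.Zmodule.on local_ring.

Definition lfrac (a : R) (s : denominator m) : local_ring := @frac R m R^o a s.

Lemma lfrac_addE a b s t :
  lfrac a s + lfrac b t = lfrac (dval t * a + dval s * b) (denom_mul s t).
Proof. exact: (@loc_addE R m R^o). Qed.

Lemma lfracW (P : local_ring -> Prop) : (forall a s, P (lfrac a s)) -> forall p, P p.
Proof. by move=> h p; apply: fracW. Qed.

Section Scale.
Variable M : lmodType R.

Definition loc_scale (a : local_ring) (p : localization m M) : localization m M :=
  frac (((repr a).1 : R) *: (repr p).1) (denom_mul (repr a).2 (repr p).2).

Lemma loc_scaleE (a : R) s (x : M) t :
  loc_scale (lfrac a s) (frac x t) = frac (a *: x) (denom_mul s t).
Proof.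
rewrite /loc_scale /lfrac.
case: (repr (frac _ s)) (frac_repr (frac (a : R^o) s)) => a' s' /= /fracP[u mu].
rewrite /GRing.scale /= => e.
case: (repr (frac x t)) (frac_repr (frac x t)) => y' t' /= /fracP[v mv f].
apply/fracP; exists (u * v); first exact: maximal_prime.
transitivity ((u * (dval s * a')) *: (v *: (dval t *: y'))).
  by rewrite !scalerA ?dval_denomE; congr (_ *: _); ring.
by rewrite -e -f !scalerA ?dval_denomE; congr (_ *: _); ring.
Qed.

Let eq_frac (x y : M) (s t : denominator m) :
  dval t *: x = dval s *: y -> frac x s = frac y t.
Proof. by move=> e; apply/fracP; exists 1; [exact: maximal1|rewrite e]. Qed.

Lemma loc_scale1 : left_id (lfrac 1 (denom1 m)) loc_scale.
Proof.
move=> p; elim/fracW: p => x s; rewrite loc_scaleE; apply: eq_frac; rewrite ?dval_denomE.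
by rewrite !scalerA; congr (_ *: _); ring.
Qed.

Lemma loc_scaleDr : right_distributive loc_scale +%R.
Proof.
move=> a p q; elim/lfracW: a => a r; elim/fracW: p => x s; elim/fracW: q => y t.
rewrite frac_addE !loc_scaleE frac_addE.
apply: eq_frac; rewrite ?dval_denomE.
by rewrite !scalerDr !scalerA; congr (_ *: _ + _ *: _); ring.
Qed.

Lemma loc_scaleDl (p : localization m M) : {morph loc_scale^~ p : a b / a + b}.
Proof.
move=> a b /=; elim/lfracW: a => a r; elim/lfracW: b => b s; elim/fracW: p => x t.
rewrite lfrac_addE !loc_scaleE frac_addE.
apply: eq_frac; rewrite ?dval_denomE; rewrite !scalerDr !scalerA -scalerDl.
by rewrite /GRing.scale /=; congr (_ *: _); ring.
Qed.

End Scale.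

Definition loc_mul (a b : local_ring) : local_ring := @loc_scale R^o a b.

Lemma loc_mulE (a b : R) s t :
  loc_mul (lfrac a s) (lfrac b t) = lfrac (a * b) (denom_mul s t).
Proof. exact: (@loc_scaleE R^o). Qed.

Let eq_lfrac (a b : R) (s t : denominator m) :
  dval t * a = dval s * b -> lfrac a s = lfrac b t.
Proof.
by move=> e; apply/fracP; exists 1; [exact: maximal1|rewrite /GRing.scale /= e].
Qed.

Lemma loc_scaleA (M : lmodType R) (a b : local_ring) (p : localization m M) :
  loc_scale a (loc_scale b p) = loc_scale (loc_mul a b) p.
Proof.
elim/lfracW: a => a r; elim/lfracW: b => b s; elim/fracW: p => x t.
rewrite loc_mulE !loc_scaleE; apply/fracP; exists 1; first exact: maximal1.
by rewrite !scalerA !dval_denomE; congr (_ *: _); ring.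
Qed.

Lemma loc_mulA : associative loc_mul.
Proof. by move=> a b c; apply: loc_scaleA. Qed.

Lemma loc_mulC : commutative loc_mul.
Proof.
move=> a b; elim/lfracW: a => a r; elim/lfracW: b => b s.
by rewrite !loc_mulE; apply: eq_lfrac; rewrite !dval_denomE; ring.
Qed.

Lemma loc_mul1 : left_id (lfrac 1 (denom1 m)) loc_mul.
Proof. by move=> a; apply: loc_scale1. Qed.

Lemma loc_mulDl : left_distributive loc_mul +%R.
Proof. by move=> a b c; apply: loc_scaleDl. Qed.

Lemma loc_1neq0 : lfrac 1 (denom1 m) != 0.
Proof.
apply/eqP => /fracP[u mu]; rewrite /GRing.scale /= => e.
by apply: mu; move: e; rewrite !mulr1 !mulr0 => ->; exact: maximal0.
Qed.

HB.instance Definition _ := GRing.Zmodule_isComNzRing.Build local_ring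
  loc_mulA loc_mulC loc_mul1 loc_mulDl loc_1neq0.

End LocalRing.

HB.instance Definition _ (R : comNzRingType) (m : maximal_ideal R) (M : lmodType R) :=
  GRing.Zmodule_isLmodule.Build (local_ring m) (localization m M)
    (@loc_scaleA R m M) (@loc_scale1 R m M) (@loc_scaleDr R m M) (@loc_scaleDl R m M).

Lemma loc_lmodE (R : comNzRingType) (m : maximal_ideal R) (M : lmodType R)
    (a : R) (x : M) (s t : denominator m) :
  lfrac a s *: frac x t = frac (a *: x) (denom_mul s t).
Proof. exact: loc_scaleE. Qed.

Definition arithmetical_module (R : comNzRingType) (M : lmodType R) : Prop :=
  forall (m : maximal_ideal R) (A B : set (localization m M)),
    @is_submodule (local_ring m) (localization m M) A ->
    @is_submodule (local_ring m) (localization m M) B ->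
    A `<=` B \/ B `<=` A.

(* Main.v *)
(* Each of the five conditions is equivalent to [locally_comparable]: for all
   x, y in M there are a + b = 1 with a y in R x and b x in R y, that is,
   (Rx : y) + (Ry : x) = R. This makes every finitely generated submodule N
   locally cyclic: an ideal is all of R as soon as it contains the scalars c
   such that c N lies in a cyclic submodule of N. *)
Require Import Defs.
From mathcomp Require Import all_boot all_order all_algebra.
From mathcomp Require Import boolp classical_sets.
From mathcomp Require Import ring.
(* Imported again so that [span] is not the one of [vector]. *)
Import Defs.

Set Implicit Arguments.
Unset Strict Implicit.
Unset Printing Implicit Defensive.

Import GRing.Theory.

Local Open Scope classical_set_scope.
Local Open Scope ring_scope.

(** * Submodules, cyclic submodules and colon ideals *)

Section Submodules.
Context {R : comNzRingType} {M : lmodType R}.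
Implicit Types (K L N : set M) (x y : M) (a b c : R).

Lemma is_submodule0 N : is_submodule N -> N 0.
Proof. by case/is_submoduleP. Qed.

Lemma is_submoduleD N x y : is_submodule N -> N x -> N y -> N (x + y).
Proof. by case/is_submoduleP => _ h Nx Ny; rewrite -[x]scale1r; apply: h. Qed.

Lemma is_submoduleZ N a x : is_submodule N -> N x -> N (a *: x).
Proof. by case/is_submoduleP => N0 h Nx; rewrite -[_ *: _]addr0; apply: h. Qed.

Lemma is_submoduleB N x y : is_submodule N -> N x -> N y -> N (x - y).
Proof.
by move=> sN Nx Ny; apply: is_submoduleD => //; rewrite -scaleN1r; apply: is_submoduleZ.
Qed.

Lemma sub_span (X : set M) : X `<=` span X.
Proof. by move=> x Xx A [_]; apply. Qed.

Lemma span_min (X N : set M) : is_submodule N -> X `<=` N -> span X `<=` N.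
Proof. by move=> sN XN x; apply. Qed.

Lemma span_submodule (X : set M) : is_submodule (span X).
Proof.
apply/is_submoduleP; split=> [A [sA _]|a x y Xx Xy A hA]; first exact: is_submodule0.
have [sA _] := hA.
by apply: is_submoduleD => //; [apply: is_submoduleZ => //; apply: Xx|apply: Xy].
Qed.

Definition cyclic x : set M := [set z | exists a, z = a *: x].

Lemma cyclic_submodule x : is_submodule (cyclic x).
Proof.
apply/is_submoduleP; split=> [|a _ _ [b ->] [c ->]]; first by exists 0; rewrite scale0r.
by exists (a * b + c); rewrite scalerDl scalerA.
Qed.

Lemma mem_cyclic x : cyclic x x.
Proof. by exists 1; rewrite scale1r. Qed.

Lemma cyclic_min x N : is_submodule N -> N x -> cyclic x `<=` N.
Proof. by move=> sN Nx _ [a ->]; apply: is_submoduleZ. Qed.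

Lemma cyclic_fg x : finitely_generated (cyclic x).
Proof.
exists [:: x]; apply/seteqP; split.
  by apply: cyclic_min; [exact: span_submodule|apply: sub_span; rewrite /= inE].
apply: span_min; [exact: cyclic_submodule|].
by move=> z /=; rewrite inE => /eqP ->; exact: mem_cyclic.
Qed.

Lemma sum_set_submodule K L : is_submodule K -> is_submodule L -> is_submodule (sum_set K L).
Proof.
move=> sK sL; apply/is_submoduleP; split.
  by exists 0; [exact: is_submodule0|exists 0; [exact: is_submodule0|rewrite addr0]].
move=> a _ _ [x Kx [y Ly <-]] [x' Kx' [y' Ly' <-]].
exists (a *: x + x'); first by apply: is_submoduleD => //; apply: is_submoduleZ.
exists (a *: y + y'); first by apply: is_submoduleD => //; apply: is_submoduleZ.
by rewrite scalerDr addrACA.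
Qed.

Lemma sub_sum_setl K L : is_submodule L -> K `<=` sum_set K L.
Proof. by move=> sL x Kx; exists x => //; exists 0; [exact: is_submodule0|rewrite addr0]. Qed.

Lemma sub_sum_setr K L : is_submodule K -> L `<=` sum_set K L.
Proof. by move=> sK x Lx; exists 0; [exact: is_submodule0|exists x; rewrite ?add0r]. Qed.

Lemma capI_submodule K L : is_submodule K -> is_submodule L -> is_submodule (K `&` L).
Proof.
move=> sK sL; apply/is_submoduleP; split; first by split; exact: is_submodule0.
by move=> a x y [? ?] [? ?]; split; apply: is_submoduleD => //; apply: is_submoduleZ.
Qed.

Lemma colon_ideal K N : is_submodule K -> is_ideal (colon K N).
Proof.
move=> sK; apply/is_submoduleP; split=> [x Nx|a b c Kb Kc x Nx].
  by rewrite scale0r; exact: is_submodule0.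
rewrite scalerDl -scalerA; apply: is_submoduleD => //; last exact: Kc.
by apply: is_submoduleZ => //; apply: Kb.
Qed.

Lemma colon_span K (X : set M) a :
  is_submodule K -> (forall x, X x -> K (a *: x)) -> colon K (span X) a.
Proof.
move=> sK KX; apply: span_min => //; apply/is_submoduleP; split.
  by rewrite scaler0; exact: is_submodule0.
move=> b x y Kx Ky; rewrite scalerDr scalerA mulrC -scalerA.
by apply: is_submoduleD => //; apply: is_submoduleZ.
Qed.

Lemma colon_cyclicP K x a : is_submodule K -> colon K (cyclic x) a <-> K (a *: x).
Proof.
move=> sK; split=> [h|Kax _ [b ->]]; first exact/h/mem_cyclic.
by rewrite scalerA mulrC -scalerA; apply: is_submoduleZ.
Qed.

(** Supplies most of the ideals to which the local cyclicity lemmas are applied; taking [R^o] for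
    [M] covers the sets of [c] with [J (c * r)]. *)
Lemma preim_ideal x N : is_submodule N -> is_ideal [set c | N (c *: x)].
Proof.
move=> sN; apply/is_submoduleP; split=> [|a b c] /=.
  by rewrite scale0r; exact: is_submodule0.
move=> Nb Nc; rewrite scalerDl -scalerA.
by apply: is_submoduleD => //; apply: is_submoduleZ.
Qed.

End Submodules.

(** * Ideals and the existence of maximal ideals *)

Section Ideals.
Context {R : comNzRingType}.

Lemma ideal_ext (I : set R) : is_ideal I ->
  [/\ I 0, forall a b, I a -> I b -> I (a + b) & forall a b, I b -> I (a * b)].
Proof.
move=> iI; split; first exact: (is_submodule0 (M := R^o)).
  by move=> a b; apply: (is_submoduleD (M := R^o)).
by move=> a b; apply: (is_submoduleZ (M := R^o)).
Qed.

Lemma exists_maximal_ideal (I : set R) :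
  is_ideal I -> ~ I 1 -> exists m : maximal_ideal R, I `<=` maximal_set m.
Proof.
move=> iI I1.
(* Joining I to each member of the chain makes the empty chain harmless. *)
pose P := [set X : set R | is_ideal (I `|` X) /\ ~ (I `|` X) 1].
have [F FP Ftot|A [[iA A1] Amax]] := @Zorn_bigcup R P.
  split; last first.
    by case=> // -[X FX X1]; have [_] := FP _ FX; apply; right.
  have sub X : F X -> I `|` X `<=` I `|` \bigcup_(Y in F) Y.
    by move=> FX z [Iz|Xz]; [left|right; exists X].
  have lin X a (x y : R) : F X -> (I `|` X) x -> (I `|` X) y ->
      (I `|` \bigcup_(Y in F) Y) (a * x + y).
    move=> FX Xx Xy; apply: (sub X FX).
    by have [_ D Z] := ideal_ext (FP _ FX).1; apply: D => //; apply: Z.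
  have [I0 ID IZ] := ideal_ext iI.
  apply/is_submoduleP; split; first by left.
  move=> a x y [Ix|[X FX Xx]] [Iy|[Y FY Yy]].
  - by left; apply: ID => //; apply: IZ.
  - by apply: (lin Y) => //; [left|right].
  - by apply: (lin X) => //; [right|left].
  - by case: (Ftot X Y FX FY) => h;
      [apply: (lin Y)|apply: (lin X)] => //; right => //; apply: h.
have proper : I `|` A <> setT by move=> e; apply: A1; rewrite e.
have maxA (J : set R) : is_ideal J -> I `|` A `<=` J -> J <> setT -> J = I `|` A.
  move=> iJ AJ JT; apply/seteqP; split=> // x Jx; apply: contrapT => Ax.
  (* Zorn compares [A] with sets [X] for which [I] joined with [X] is a proper ideal; since [J]
     contains [I], it is itself such a set. *)
  have IJ : I `|` J = J.
    by apply/seteqP; split=> [z [Iz|]//|z Jz]; [apply: AJ; left|right].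
  apply: (Amax J).
    split=> [z Az|JA]; first by apply: AJ; right.
    by apply: Ax; right; apply: JA.
  split; rewrite IJ // => J1; apply: JT; apply/seteqP; split=> // z _.
  by have [_ _ Z] := ideal_ext iJ; rewrite -[z]mulr1; apply: Z.
by exists (MaximalIdeal iA proper maxA) => x Ix; left.
Qed.

End Ideals.

(** * Local comparability and local cyclicity *)

Definition locally_comparable {R : comNzRingType} (M : lmodType R) : Prop :=
  forall x y : M, exists a b : R,
    [/\ a + b = 1, cyclic x (a *: y) & cyclic y (b *: x)].

Section LocallyComparable.
Context {R : comNzRingType} {M : lmodType R}.
Implicit Types (K L N : set M) (x y : M) (a b c : R).

Lemma locally_comparable_colon :
  (forall x y, sum_set (colon (cyclic x) (cyclic y)) (colon (cyclic y) (cyclic x)) 1) ->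
  locally_comparable M.
Proof.
move=> h x y; have [a ay [b bx ab]] := h x y.
by exists a, b; split=> //; [apply: ay|apply: bx]; exact: mem_cyclic.
Qed.

(* I is only assumed to contain c^2, because [fg_multiplication] can only
   control c^2; the induction survives since a + b = 1 implies that a^2 and b^2
   are comaximal. *)
Lemma locally_cyclic (hM : locally_comparable M) (N : set M) (I : set R) :
  finitely_generated N -> is_ideal I ->
  (forall c x, N x -> colon (cyclic x) N c -> I (c * c)) -> I 1.
Proof.
move=> [s ->] iI; have [_ ID IM] := ideal_ext iI.
elim: s => [|y s IHs] hI.
  (* Without generators [N] is zero, so [1] maps it into the cyclic submodule of [0]. *)
  rewrite -[1]mulr1; apply: (hI 1 0); first exact: is_submodule0 (span_submodule _).
  by apply: colon_span; [exact: cyclic_submodule|].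
have sub_s : span [set` s] `<=` span [set` y :: s].
  apply: span_min; first exact: span_submodule.
  by move=> z /= sz; apply: sub_span; rewrite /= inE sz orbT.
apply: IHs => c x sx cx; have [a [b [ab ay bx]]] := hM x y.
have cons_colon d u : cyclic u (d *: y) -> colon (cyclic u) (span [set` s]) d ->
    colon (cyclic u) (span [set` y :: s]) d.
  move=> dy ds; apply: colon_span; first exact: cyclic_submodule.
  move=> z /=; rewrite inE => /orP[/eqP ->//|sz].
  by apply: ds; apply: sub_span.
(* Every generator is sent into [R x] by [a * c], and into [R y] by [b * c]. *)
have Ia : I (a * c * (a * c)).
  apply: (hI _ x); first exact: sub_s.
  apply: cons_colon.
    by rewrite mulrC -scalerA; apply: is_submoduleZ; [exact: cyclic_submodule|].
  by move=> z /cx h; rewrite -scalerA; apply: is_submoduleZ; [exact: cyclic_submodule|].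
have Ib : I (b * c * (b * c)).
  apply: (hI _ y); first by apply: sub_span; rewrite /= inE eqxx.
  apply: cons_colon; first by exists (b * c).
  move=> z /cx [d cz]; rewrite -scalerA cz scalerA mulrC -scalerA.
  by apply: is_submoduleZ; [exact: cyclic_submodule|].
(* The cube of [a + b], with its terms grouped into a multiple of the square of [a] and one of the
   square of [b]. *)
have -> : c * c = (a + 3 * b) * (a * c * (a * c)) + (3 * a + b) * (b * c * (b * c)).
  by transitivity ((a + b) ^+ 3 * (c * c)); [rewrite ab expr1n mul1r|ring].
by apply: ID; apply: IM.
Qed.

(** The form for ideals that contain [c] itself, and hence [c * c]. *)
Lemma locally_cyclic_colon (hM : locally_comparable M) (N : set M) (I : set R) :
  finitely_generated N -> is_ideal I ->
  (forall c x, N x -> colon (cyclic x) N c -> I c) -> I 1.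
Proof.
move=> fN iI hI; apply: (locally_cyclic hM fN iI) => c x Nx cx.
by have [_ _ IM] := ideal_ext iI; apply: IM; apply: hI cx.
Qed.

(** * Comparison with the localizations *)

(** If (Rx : y) + (Ry : x) were proper, it would lie in some [m]. Over [R_m] one of x/1, y/1 is a
    multiple of the other, and clearing denominators puts a scalar outside [m] into one of the two
    colon ideals. *)
Lemma arithmetical_locally_comparable :
  arithmetical_module M -> locally_comparable M.
Proof.
move=> arith; apply: locally_comparable_colon => x y.
set I := sum_set _ _.
have iI : is_ideal I.
  by apply: (sum_set_submodule (M := R^o)); apply: colon_ideal; exact: cyclic_submodule.
apply: contrapT => /(exists_maximal_ideal iI)[m Im].
have not_cyclic (u v : M) : colon (cyclic v) (cyclic u) `<=` I ->
    ~ @cyclic (local_ring m) _ (frac v (denom1 m)) (frac u (denom1 m)).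
  move=> uI [p]; elim/lfracW: p => a s; rewrite loc_lmodE => /fracP[w mw].
  rewrite !dval_denomE scale1r mulr1 => e.
  apply: (maximal_prime mw (denomP (s := s))); apply/Im/uI.
  apply/colon_cyclicP; first exact: cyclic_submodule.
  by exists (w * a); rewrite -!scalerA.
have I1 : colon (cyclic x) (cyclic y) `<=` I.
  by apply: (sub_sum_setl (M := R^o)); exact/colon_ideal/cyclic_submodule.
have I2 : colon (cyclic y) (cyclic x) `<=` I.
  by apply: (sub_sum_setr (M := R^o)); exact/colon_ideal/cyclic_submodule.
have := arith m _ _ (cyclic_submodule (frac x (denom1 m)))
  (cyclic_submodule (frac y (denom1 m))).
by case=> h; [apply: (not_cyclic x y I2)|apply: (not_cyclic y x I1)];
  apply: h; exact: mem_cyclic.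
Qed.

(** As a + b = 1, one of [a], [b] lies outside [m] and is invertible in [R_m], so of two fractions
    one is always a multiple of the other. Incomparable [A] and [B] would provide two fractions
    violating this. *)
Lemma locally_comparable_arithmetical :
  locally_comparable M -> arithmetical_module M.
Proof.
move=> hM m A B sA sB.
have frac_scale (x y : M) (s t : denominator m) a : ~ maximal_set m a ->
    cyclic x (a *: y) -> exists p : local_ring m, frac y t = p *: frac x s.
  move=> ma [g e].
  (* From a y = g x follows y/t = (g s)/(a t) * x/s. *)
  exists (lfrac (g * dval s) (denom_mul (Sub a (notin_maximal ma)) t)).
  rewrite loc_lmodE; apply/fracP; exists 1; first exact: maximal1.
  have -> : dval (denom_mul (denom_mul (Sub a (notin_maximal ma)) t) s) *: y
      = (dval t * dval s) *: (a *: y).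
    by rewrite scalerA; congr (_ *: _); rewrite !dval_denom_mul /dval /=; ring.
  by rewrite e !scalerA; congr (_ *: _); ring.
apply: contrapT => /not_orP[/existsNP[p /not_implyP[Ap Bp]] /existsNP[q /not_implyP[Bq Aq]]].
elim/fracW: p Ap Bp => x s Ax Bx; elim/fracW: q Bq Aq => y t By Ay.
have [a [b [ab ay bx]]] := hM x y.
have [ma|ma] := pselect (maximal_set m a); last first.
  by have [p e] := frac_scale x y s t a ma ay; apply: Ay; rewrite e; apply: is_submoduleZ.
have mb : ~ maximal_set m b.
  by move=> mb; apply: (@maximal1 R m); rewrite -ab -[a]mul1r; apply: maximal_lin.
by have [p e] := frac_scale y x t s b mb bx; apply: Bx; rewrite e; apply: is_submoduleZ.
Qed.

(** * Distributivity *)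

(** Writes x + y as a sum of an element of [R y] and one of [R x] that are both multiples of x + y,
    and so stay in every submodule containing x + y. *)
Lemma locally_comparable_split (hM : locally_comparable M) x y : exists a b,
  [/\ a + b = 1, cyclic y (a *: (x + y)) & cyclic x (b *: (x + y))].
Proof.
have [a [b [ab [c ay] [d bx]]]] := hM x y; exists b, a; split; first by rewrite addrC.
  by exists (d + b); rewrite scalerDr bx scalerDl.
by exists (a + c); rewrite scalerDr ay scalerDl.
Qed.

Lemma locally_comparable_distributive :
  locally_comparable M -> distributive_module M.
Proof.
move=> hM N sN K L sK sL; apply/seteqP; split; last first.
  move=> _ [k [Kk Nk] [l [Ll Nl] <-]]; split; first by exists k => //; exists l.
  exact: is_submoduleD.
move=> _ [[k Kk [l Ll <-]] Nkl].
have [a [b [ab al bk]]] := locally_comparable_split hM k l.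
exists (b *: (k + l)).
  by split; [apply: cyclic_min bk|apply: is_submoduleZ].
exists (a *: (k + l)).
  by split; [apply: cyclic_min al|apply: is_submoduleZ].
by rewrite -scalerDl addrC ab scale1r.
Qed.

(** Distributivity for [R x], [R y] and R(x + y) gives x + y = r (x + y) + s (x + y) with the first
    term in [R x] and the second in [R y]; hence r y is in [R x] and s x is in [R y]. But r + s is 1
    only modulo the annihilator of x + y. *)
Lemma distributive_locally_comparable :
  distributive_module M -> locally_comparable M.
Proof.
move=> dM x y.
have sc := @cyclic_submodule R M.
have : (sum_set (cyclic x) (cyclic y) `&` cyclic (x + y)) (x + y).
  split; last exact: mem_cyclic.
  by exists x; [|exists y => //]; exact: mem_cyclic.
rewrite dM // => -[u [[f rx] [r ur]] [v [[g sy] [s vs]] e]].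
rewrite {u}ur in rx e; rewrite {v}vs in sy e.
(* (r + s) (x + y) = x + y, so the annihilator term 1 - r - s can be moved to r. *)
have e0 : (1 - r - s) *: y = - ((1 - r - s) *: x).
  apply/eqP; rewrite -addr_eq0 -scalerDr [y + x]addrC !scalerBl scale1r.
  by rewrite -addrA -opprD e subrr.
exists (1 - s), s; split; first by rewrite subrK.
  have -> : 1 - s = (1 - r - s) + r by ring.
  rewrite scalerDl e0.
  apply: is_submoduleD => //; first by exists (- (1 - r - s)); rewrite scaleNr.
  by exists (f - r); rewrite scalerBl -rx scalerDr [X in X - _]addrC addrK.
by exists (g - s); rewrite scalerBl -sy scalerDr addrK.
Qed.

(** * Colon ideals of sums and intersections *)

(** By local cyclicity it suffices to treat c r where c N lies in [R n]. Splitting r n = k + l into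
    its multiples by [b] and [a] then splits c r into b c r and a c r. *)
Lemma locally_comparable_colonD (hM : locally_comparable M) K L N :
  is_submodule K -> is_submodule L -> finitely_generated N ->
  colon (sum_set K L) N = sum_set (colon K N) (colon L N).
Proof.
move=> sK sL fN; apply/seteqP; split; last first.
  move=> _ [r Kr [s Ls <-]] x Nx; exists (r *: x); first exact: Kr.
  by exists (s *: x); [exact: Ls|rewrite scalerDl].
move=> r rN; set J := sum_set _ _.
have iJ : is_ideal J by apply: (sum_set_submodule (M := R^o)); apply: colon_ideal.
rewrite -[r]mul1r; apply: (locally_cyclic_colon hM (I := [set c | J (c * r)]) fN).
  exact: (preim_ideal (M := R^o)).
move=> c n Nn cN /=; have [k Kk [l Ll kl]] := rN _ Nn.
have [a [b [ab al bk]]] := locally_comparable_split hM k l.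
have scale_colon (P : set M) d : is_submodule P -> P (d *: (k + l)) ->
    colon P N (d * c * r).
  move=> sP Pd z /cN[g cz].
  have -> : (d * c * r) *: z = g *: (d *: (k + l)).
    by rewrite kl mulrAC -scalerA cz !scalerA; congr (_ *: _); ring.
  exact: is_submoduleZ.
exists (b * c * r); first by apply: scale_colon => //; apply: cyclic_min bk.
exists (a * c * r); first by apply: scale_colon => //; apply: cyclic_min al.
by rewrite -!mulrDl addrC ab mul1r.
Qed.

(** The case [R x], [R y], R(x + y), where [1] lies in the left-hand side: if r (x + y) is in [R x],
    so is r y. *)
Lemma colonD_locally_comparable :
  (forall K L N, is_submodule K -> is_submodule L -> is_submodule N ->
     finitely_generated N ->
     colon (sum_set K L) N = sum_set (colon K N) (colon L N)) ->
  locally_comparable M.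
Proof.
have sc := @cyclic_submodule R M.
move=> h x y; have : colon (sum_set (cyclic x) (cyclic y)) (cyclic (x + y)) 1.
  apply/colon_cyclicP; first exact: sum_set_submodule.
  by exists x; [|exists y; rewrite ?scale1r //]; exact: mem_cyclic.
rewrite h //; last exact: cyclic_fg.
move=> [r /colon_cyclicP rx [s /colon_cyclicP sy rs]].
exists r, s; split=> //.
  have -> : r *: y = r *: (x + y) - r *: x by rewrite scalerDr addrC addKr.
  by apply: is_submoduleB => //; [exact: rx|exists r].
have -> : s *: x = s *: (x + y) - s *: y by rewrite scalerDr addrK.
by apply: is_submoduleB => //; [exact: sy|exists s].
Qed.

(** Local cyclicity is used for [L] and for [N]: c L lies in [R l] and d N in [R n]. Comparing [n]
    with [l] puts a l and b n into both [L] and [N], where [r] maps into [K]; so a c r is in (K : L)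
    and b d r in (K : N). *)
Lemma locally_comparable_colonI (hM : locally_comparable M) K L N :
  is_submodule K -> is_submodule L -> is_submodule N ->
  finitely_generated L -> finitely_generated N ->
  colon K (L `&` N) = sum_set (colon K L) (colon K N).
Proof.
move=> sK sL sN fL fN; apply/seteqP; split; last first.
  move=> _ [r Kr [s Ks <-]] x [Lx Nx]; rewrite scalerDl.
  by apply: is_submoduleD => //; [exact: Kr|exact: Ks].
move=> r rLN; set J := sum_set _ _.
have iJ : is_ideal J by apply: (sum_set_submodule (M := R^o)); apply: colon_ideal.
rewrite -[r]mul1r; apply: (locally_cyclic_colon hM (I := [set c | J (c * r)]) fL).
  exact: (preim_ideal (M := R^o)).
move=> c l Ll cL /=; rewrite -[c * r]mul1r.
apply: (locally_cyclic_colon hM (I := [set d | J (d * (c * r))]) fN).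
  exact: (preim_ideal (M := R^o)).
move=> d n Nn dN /=; have [a [b [ab bn al]]] := hM n l.
have scale_colon (P : set M) u e f : colon (cyclic u) P e ->
    L (f *: u) -> N (f *: u) -> colon K P (f * e * r).
  move=> eP Lu Nu z /eP[g ez].
  have -> : (f * e * r) *: z = g *: (r *: (f *: u)).
    by rewrite mulrAC -scalerA ez !scalerA; congr (_ *: _); ring.
  by apply: is_submoduleZ => //; apply: rLN.
have [_ _ cK] := ideal_ext (colon_ideal L sK); have [_ _ cK'] := ideal_ext (colon_ideal N sK).
(* The extra factors [d] and [c] make the two terms add up to (a + b) d c r. *)
exists (d * (a * c * r)).
  apply: cK; apply: (scale_colon _ l) => //; first exact: is_submoduleZ.
  exact: cyclic_min bn.
exists (c * (b * d * r)).
  apply: cK'; apply: (scale_colon _ n) => //; last exact: is_submoduleZ.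
  exact: cyclic_min al.
by rewrite -[d * (c * r)]mul1r -ab; ring.
Qed.

(** With [K] the intersection of [R x] and [R y], the left-hand side contains [1], while (K : Ry) is
    contained in (Rx : Ry) and (K : Rx) in (Ry : Rx). *)
Lemma colonI_locally_comparable :
  (forall K L N, is_submodule K -> is_submodule L -> is_submodule N ->
     finitely_generated L -> finitely_generated N ->
     colon K (L `&` N) = sum_set (colon K L) (colon K N)) ->
  locally_comparable M.
Proof.
move=> h; apply: locally_comparable_colon => x y.
have sc := @cyclic_submodule R M.
have : colon (cyclic x `&` cyclic y) (cyclic y `&` cyclic x) 1.
  by move=> z [yz xz]; rewrite scale1r.
rewrite h //; [|exact: capI_submodule|exact: cyclic_fg|exact: cyclic_fg].
by move=> [r rP [s sP rs]]; exists r => [z /rP[]|] //; exists s => // z /sP[].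
Qed.

(** * Multiplication modules *)

Lemma ideal_mul_colon (Y N : set M) :
  is_submodule Y -> ideal_mul (colon Y N) N `<=` Y.
Proof. by move=> sY; apply: span_min => // _ [a aP [x Nx <-]]; apply: aP. Qed.

(** The ideal is (Y : N). If c N lies in [R n] and c y = e n, then c e maps [N] into R c y, hence
    into [Y], and the square of [c] sends [y] to (c e) n. This is where only the square of [c] is
    controlled. *)
Lemma fg_multiplication (hM : locally_comparable M) N :
  finitely_generated N -> multiplication_module N.
Proof.
move=> fN Y sY YN; exists (colon Y N); first exact: colon_ideal.
apply/seteqP; split; last exact: ideal_mul_colon.
move=> y Yy; rewrite -[y]scale1r.
apply: (locally_cyclic hM (I := [set c | ideal_mul (colon Y N) N (c *: y)]) fN).
  exact/preim_ideal/span_submodule.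
move=> c n Nn cN /=; have [e cy] := cN _ (YN _ Yy).
rewrite -scalerA cy scalerA; apply: sub_span; exists (c * e); last by exists n.
move=> z /cN[g cz]; rewrite mulrC -scalerA cz scalerA mulrC -scalerA -cy.
by apply: is_submoduleZ => //; apply: is_submoduleZ.
Qed.

(** For N = Rx + Ry write Rx = I N = I x + I y, so x = a x + b y with [a], [b] in [I]. Then a y is
    in I N = Rx and (1 - a) x = b y. *)
Lemma multiplication_locally_comparable :
  (forall N, is_submodule N -> finitely_generated N -> multiplication_module N) ->
  locally_comparable M.
Proof.
move=> h x y; set N := span [set` [:: x; y]].
have sN : is_submodule N by exact: span_submodule.
have Nx : N x by apply: sub_span; rewrite /= inE eqxx.
have Ny : N y by apply: sub_span; rewrite /= !inE eqxx orbT.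
have fN : finitely_generated N by exists [:: x; y].
have [I iI xI] := h N sN fN _ (cyclic_submodule x) (cyclic_min sN Nx).
have [I0 ID IM] := ideal_ext iI.
have Iz z a : I a -> N z -> cyclic x (a *: z).
  by move=> Ia Nz; rewrite xI; apply: sub_span; exists a => //; exists z.
have Nxy : N `<=` [set z | exists p q, z = p *: x + q *: y].
  apply: span_min.
    apply/is_submoduleP; split; first by exists 0, 0; rewrite !scale0r addr0.
    move=> a _ _ [p [q ->]] [p' [q' ->]]; exists (a * p + p'), (a * q + q').
    by rewrite scalerDr !scalerDl !scalerA addrACA.
  move=> z /=; rewrite !inE => /orP[]/eqP->.
    by exists 1, 0; rewrite scale1r scale0r addr0.
  by exists 0, 1; rewrite scale1r scale0r add0r.
have IN : ideal_mul I N `<=` [set z | exists a b, [/\ I a, I b & z = a *: x + b *: y]].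
  apply: span_min.
    apply/is_submoduleP; split; first by exists 0, 0; rewrite !scale0r addr0.
    move=> c _ _ [a [b [Ia Ib ->]]] [a' [b' [Ia' Ib' ->]]].
    exists (c * a + a'), (c * b + b'); split; try by apply: ID => //; apply: IM.
    by rewrite scalerDr !scalerDl !scalerA addrACA.
  move=> _ [a Ia [z /Nxy[p [q ->]] <-]]; exists (p * a), (q * a).
  by split; [exact: IM|exact: IM|rewrite scalerDr !scalerA ![a * _]mulrC].
have [a [b [Ia Ib e]]] : exists a b, [/\ I a, I b & x = a *: x + b *: y].
  by apply: IN; rewrite -xI; exact: mem_cyclic.
exists a, (1 - a); split; first by rewrite addrC subrK.
  exact: Iz.
by exists b; rewrite scalerBl scale1r {1}e addrC addKr.
Qed.

End LocallyComparable.

Theorem theorem3p1 (R : comNzRingType) (M : lmodType R) :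
  [<-> arithmetical_module M;
       distributive_module M;
       forall K L N : set M,
         is_submodule K -> is_submodule L -> is_submodule N ->
         finitely_generated N ->
         colon (sum_set K L) N = sum_set (colon K N) (colon L N);
       forall K L N : set M,
         is_submodule K -> is_submodule L -> is_submodule N ->
         finitely_generated L -> finitely_generated N ->
         colon K (L `&` N) = sum_set (colon K L) (colon K N);
       forall N : set M,
         is_submodule N -> finitely_generated N -> multiplication_module N].
Proof.
tfae=> [|||| h m].
- by move=> /arithmetical_locally_comparable; apply: locally_comparable_distributive.
- move=> /distributive_locally_comparable hM K L N sK sL _.
  exact: locally_comparable_colonD.
- move=> /colonD_locally_comparable hM K L N sK sL sN.
  exact: locally_comparable_colonI.
- by move=> /colonI_locally_comparable hM N _; apply: fg_multiplication.
- exact/locally_comparable_arithmetical/multiplication_locally_comparable.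
Qed.
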